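(* Let $B$ be a connected building set on $[n+1]$ such that the nestohedron $P_B$ is flag, and let vectors $l_S\in\mathbb{R}^n$ and numbers $b_S$ ($S\in B\setminus\{[n+1]\}$) be obtained by the recursive shaving construction described in the context. Then the resulting realization $\{x\in\mathbb{R}^n:\ \langle l_S,x\rangle\le b_S\text{ for all }S\in B\setminus\{[n+1]\}\}$ of $P_B$ is a Delzant polytope in the standard basis of $\mathbb{R}^n$.
   Context: Write $[m]=\{1,\dots,m\}$. A building set on $[n+1]$ is a collection $B$ of nonempty subsets of $[n+1]$ such that (i) $\{i\}\in B$ for all $i\in[n+1]$; (ii) if $S_1,S_2\in B$ and $S_1\cap S_2\ne\emptyset$ then $S_1\cup S_2\in B$. It is connected if $[n+1]\in B$. The closure $\widehat{C}$ of a collection $C$ of subsets is the inclusion-minimal building set containing $C$. The nestohedron is the Minkowski sum $P_B=\sum_{S\in B}\operatorname{conv}\{e_i:i\in S\}\subset\mathbb{R}^{n+1}$; for $B$ connected it is a simple $n$-dimensional polytope whose facets $F_S$ correspond bijectively to $S\in B\setminus\{[n+1]\}$, namely $F_S$ is the facet on which $\sum_{i\in S}x_i$ is minimal. A polytope is flag if any collection of pairwise intersecting facets has nonempty intersection. An $n$-dimensional polytope in $\mathbb{R}^n$ is Delzant in the standard basis if for every vertex $v$ there are integer vectors parallel to the outer normals of the facets containing $v$ that form a $\mathbb{Z}$-basis of $\mathbb{Z}^n$. Construction. Choose a connected building set $B_0\subset B$ on $[n+1]$ with $P_{B_0}$ combinatorially equivalent to the cube $I^n$ (one exists since $P_B$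 is flag), and fix a combinatorial equivalence of $P_{B_0}$ with the cube $[-1,1]^n$; for $S\in B_0\setminus\{[n+1]\}$ let $l_S\in\{\pm e_1,\dots,\pm e_n\}$ be the outer normal of the facet of $[-1,1]^n$ corresponding to $F_S$, and $b_S=1$. Choose a chain $B_0\subset B_1\subset\dots\subset B_N=B$ with $B_i=\widehat{B_{i-1}\cup\{S^i\}}$, where $S^i$ is an inclusion-minimal element of $B\setminus B_{i-1}$. Each element $S\in B_i\setminus B_{i-1}$ is then, in a unique way, a disjoint union of two elements of $B_{i-1}$. Number the elements of $B\setminus B_0$ as $S_1,S_2,\dots$ so that elements of $B_{i-1}\setminus B_0$ precede those of $B_i\setminus B_{i-1}$, and within $B_i\setminus B_{i-1}$ larger sets (with respect to inclusion) precede smaller ones. Recursively in $j$, if $S_j\in B_i\setminus B_{i-1}$ and $S_j=S_{j_1}\sqcup S_{j_2}$ with $S_{j_1},S_{j_2}\in B_{i-1}$, put $l_{S_j}=l_{S_{j_1}}+l_{S_{j_2}}$ and $b_{S_j}=b_{S_{j_1}}+b_{S_{j_2}}-\varepsilon_j$, where $\varepsilon_j>0$ is small enough that adding the inequality $\langle l_{S_j},x\rangle\le b_{S_j}$ to those already present shaves off the face $F_{S_{j_1}}\cap F_{S_{j_2}}$ of the current polytope; i.e. every vertex of the current polytope not lying on this face satisfies $\langle l_{S_j},x\rangle<b_{S_j}$. Here $F_S$ denotes the facet of the current polytope lying in $\langle l_S,x\rangle=b_S$. *)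

(* Defs.v *)
From mathcomp Require Import all_boot all_order all_algebra.
From mathcomp Require Import boolp classical_sets functions reals.

Set Implicit Arguments.
Unset Strict Implicit.
Unset Printing Implicit Defensive.

Import Order.TTheory GRing.Theory Num.Theory.
Local Open Scope ring_scope.

Section BuildingSets.
Variable n : nat.
Implicit Types (B C : {set {set 'I_n.+1}}).

(* Subsets of [n+1] = {1, ..., n+1} are encoded as subsets of 'I_n.+1. *)
Definition building_set B : bool :=
  [&& finset.set0 \notin B,
      [forall i : 'I_n.+1, [set i] \in B]
    & [forall S in B, forall T in B, (S :&: T != finset.set0) ==> (S :|: T \in B)]].

Definition connected_building_set B : bool :=
  building_set B && ([set: 'I_n.+1] \in B).

Definition is_closure C Chat : bool :=
  minset [pred B : {set {set 'I_n.+1}} | building_set B & C \subset B] Chat.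

(* B_0 \subset B_1 \subset ... \subset B_N = B, each term being the closure of
   the previous one together with a minimal element of B outside it. *)
Definition building_chain B B0 (N : nat) (Bs : nat -> {set {set 'I_n.+1}}) :=
  [/\ Bs 0%N = B0, Bs N = B &
      forall i, (i < N)%N ->
        exists2 S : {set 'I_n.+1},
          minset [pred T : {set 'I_n.+1} | T \in B :\: Bs i] S
        & is_closure (S |: Bs i) (Bs i.+1)].

(* s enumerates B \ B_0 without repetition, earlier layers first and, within a
   layer, larger sets first. *)
Definition shaving_order B B0 (N : nat) (Bs : nat -> {set {set 'I_n.+1}})
    (s : seq {set 'I_n.+1}) :=
  [/\ uniq s,
      s =i B :\: B0,
      forall i S T, (i < N)%N -> S \in Bs i :\: B0 -> T \in Bs i.+1 :\: Bs i ->
        (index S s < index T s)%N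
    & forall i S T, (i < N)%N ->
        S \in Bs i.+1 :\: Bs i -> T \in Bs i.+1 :\: Bs i ->
        T \proper S -> (index S s < index T s)%N].

End BuildingSets.

Local Open Scope classical_set_scope.

Section Polytopes.
Variable R : realType.

Definition dot m (u v : 'rV[R]_m) : R := \sum_(i < m) u 0 i * v 0 i.

Definition basis_vec m (i : 'I_m) : 'rV[R]_m := delta_mx 0 i.

Definition conv_family m (I : finType) (A : {set I}) (p : I -> 'rV[R]_m) :
    set 'rV[R]_m :=
  [set x | exists w : I -> R,
     [/\ forall i, i \in A -> 0 <= w i,
         \sum_(i in A) w i = 1
       & x = \sum_(i in A) w i *: p i]].

Definition minkowski_sum m (I : finType) (A : {set I})
    (P : I -> set 'rV[R]_m) : set 'rV[R]_m :=
  [set x | exists2 y : I -> 'rV[R]_m,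
     (forall i, i \in A -> P i (y i)) & x = \sum_(i in A) y i].

Definition bounded m (P : set 'rV[R]_m) :=
  exists M : R, forall x, P x -> forall i, `|x 0 i| <= M.

(* Polytopes as bounded intersections of finitely many closed half-spaces. *)
Definition polytope m (P : set 'rV[R]_m) :=
  bounded P /\
  exists (k : nat) (a : 'I_k -> 'rV[R]_m) (c : 'I_k -> R),
    P = [set x | forall i, dot (a i) x <= c i].

(* The affine hull of P has dimension d: for some x0 in P, the direction space
   {x - x0 | x in P} is spanned by d linearly independent vectors x - x0. *)
Definition has_dim m (P : set 'rV[R]_m) (d : nat) :=
  exists (x0 : 'rV[R]_m) (A : 'M[R]_(d, m)),
    [/\ P x0, row_free A, forall i, P (x0 + row i A)
      & forall x, P x -> (x - x0 <= A)%MS].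

Definition max_face m (P : set 'rV[R]_m) (u : 'rV[R]_m) : set 'rV[R]_m :=
  [set x | P x /\ forall y, P y -> dot u y <= dot u x].

(* Faces are nonempty; the polytope itself (u = 0) is one of them. *)
Definition faces m (P : set 'rV[R]_m) : set (set 'rV[R]_m) :=
  [set F | F !=set0 /\ exists u, F = max_face P u].

Definition vertex m (P : set 'rV[R]_m) (v : 'rV[R]_m) := faces P [set v].

Definition facets m (P : set 'rV[R]_m) : set (set 'rV[R]_m) :=
  [set F | faces P F /\ exists d, has_dim P d.+1 /\ has_dim F d].

Definition outer_normal m (P F : set 'rV[R]_m) (u : 'rV[R]_m) :=
  u != 0 /\ F = max_face P u.

Definition flag m (P : set 'rV[R]_m) :=
  forall C : set (set 'rV[R]_m), C `<=` facets P ->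
    (forall F G, C F -> C G -> F `&` G !=set0) ->
    \bigcap_(F in C) F !=set0.

(* phi is an isomorphism between the face posets of P and Q. *)
Definition comb_equivalence m k (P : set 'rV[R]_m) (Q : set 'rV[R]_k)
    (phi : set 'rV[R]_m -> set 'rV[R]_k) :=
  set_bij (faces P) (faces Q) phi /\
  forall F G, faces P F -> faces P G -> (phi F `<=` phi G <-> F `<=` G).

Definition cube n : set 'rV[R]_n := [set x | forall i, -1 <= x 0 i <= 1].

Definition Z_basis n (w : 'I_n -> 'rV[int]_n) :=
  forall z : 'rV[int]_n, exists! c : 'rV[int]_n, z = \sum_i c 0 i *: w i.

Definition parallel n (u v : 'rV[R]_n) := exists2 t : R, t != 0 & u = t *: v.

(* At each vertex v the facets through v are listed once each as G_0, ...,
   G_(n-1); in particular there are exactly n of them. *)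
Definition delzant n (P : set 'rV[R]_n) :=
  [/\ polytope P, has_dim P n &
      forall v, vertex P v ->
        exists (G : 'I_n -> set 'rV[R]_n) (w : 'I_n -> 'rV[int]_n),
          [/\ set_bij [set: 'I_n] [set F | facets P F /\ F v] G,
              forall i, exists2 u, outer_normal P (G i) u &
                parallel (map_mx intr (w i)) u
            & Z_basis w]].

Section Nestohedra.
Variable n : nat.
Implicit Types (B : {set {set 'I_n.+1}}) (S : {set 'I_n.+1}).

Definition nestohedron B : set 'rV[R]_n.+1 :=
  minkowski_sum B (fun S => conv_family S (@basis_vec n.+1)).

(* F_S; it is a facet when B is connected and S is in B \ {[n+1]}. *)
Definition nesto_facet B S : set 'rV[R]_n.+1 :=
  [set x | nestohedron B x /\
     forall y, nestohedron B y -> \sum_(i in S) x 0 i <= \sum_(i in S) y 0 i].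

Definition halfspaces (l : {set 'I_n.+1} -> 'rV[R]_n) (b : {set 'I_n.+1} -> R)
    (A : {set {set 'I_n.+1}}) : set 'rV[R]_n :=
  [set x | forall S, S \in A -> dot (l S) x <= b S].

Definition cubical_start (B0 : {set {set 'I_n.+1}})
    (phi : set 'rV[R]_n.+1 -> set 'rV[R]_n)
    (l : {set 'I_n.+1} -> 'rV[R]_n) (b : {set 'I_n.+1} -> R) :=
  comb_equivalence (nestohedron B0) (@cube n) phi /\
  forall S, S \in B0 :\ [set: 'I_n.+1]%SET ->
    [/\ exists i, l S = basis_vec i \/ l S = - basis_vec i,
        outer_normal (@cube n) (phi (nesto_facet B0 S)) (l S)
      & b S = 1].

(* P is the current polytope, cut out by B_0 \ {[n+1]} and by the sets that
   precede S in s. *)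
Definition shaving_step (B0 Bi : {set {set 'I_n.+1}})
    (s : seq {set 'I_n.+1}) (l : {set 'I_n.+1} -> 'rV[R]_n)
    (b : {set 'I_n.+1} -> R) (S : {set 'I_n.+1}) :=
  let P := halfspaces l b
    ((B0 :\ [set: 'I_n.+1]) :|: [set T in take (index S s) s])%SET in
  exists S1 S2 : {set 'I_n.+1},
    [/\ S1 \in Bi, S2 \in Bi, S1 :&: S2 = finset.set0 & S = S1 :|: S2] /\
    [/\ l S = l S1 + l S2,
        exists2 eps : R, 0 < eps & b S = b S1 + b S2 - eps
      & forall v, vertex P v ->
          ~ (dot (l S1) v = b S1 /\ dot (l S2) v = b S2) ->
          dot (l S) v < b S].

Definition shaving_construction (B B0 : {set {set 'I_n.+1}})
    (phi : set 'rV[R]_n.+1 -> set 'rV[R]_n)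
    (N : nat) (Bs : nat -> {set {set 'I_n.+1}}) (s : seq {set 'I_n.+1})
    (l : {set 'I_n.+1} -> 'rV[R]_n) (b : {set 'I_n.+1} -> R) :=
  [/\ connected_building_set B0 /\ B0 \subset B,
      cubical_start B0 phi l b,
      building_chain B B0 N Bs,
      shaving_order B B0 N Bs s
    & forall i S, (i < N)%N -> S \in Bs i.+1 :\: Bs i ->
        shaving_step B0 (Bs i) s l b S].

End Nestohedra.
End Polytopes.

(* Main.v *)
Require Import Defs.
From mathcomp Require Import all_boot all_order all_algebra.
From mathcomp Require Import boolp classical_sets functions reals.
From mathcomp Require Import lra.
Set Implicit Arguments.
Unset Strict Implicit.
Unset Printing Implicit Defensive.
Import Order.TTheory GRing.Theory Num.Theory.
Local Open Scope ring_scope.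
Local Open Scope classical_set_scope.

(** Call a polyhedron smooth, for a given list of inequalities, if it is
    bounded, has a point where all inequalities are strict, and at each of its
    vertices exactly n of the inequalities are tight, with normals forming a
    basis of the integer lattice.  Smoothness is an invariant of the shaving
    construction, and it implies the Delzant property.

    Start.  A proper face of the nestohedron of a connected building set B_0
    lies in some F_S, because the maximizers of a functional u over a Minkowski
    sum of simplices are found simplex by simplex
    ([proper_face_in_nesto_facet]); and distinct S have distinct F_S, because
    the simplex of the whole ground set is a summand ([nesto_facet_inj]).
    Transported by the combinatorial equivalence with the cube, these facts say
    that S |-> l_S is a bijection from B_0 without the ground set onto the
    vectors plus or minus e_i.  So the first polyhedron is the cube, each
    facet listed once ([cubical_smooth]).

    Step.  Let the inequality with normal l_S = l_S1 + l_S2 be added.  A new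
    vertex lies inside an edge of the old polyhedron, one end p of which is cut
    off; by the choice of epsilon p lies on both walls S1 and S2.  The edge lies
    on all walls at p but one, and it cannot lie on both S1 and S2, as all such
    points are cut off.  So the normals at the new vertex are those at p with
    l_S1 (or l_S2) replaced by l_S1 + l_S2: an elementary row operation, which
    keeps a lattice basis a lattice basis ([shaved_corner], [smooth_shave]).
    If the walls S1 and S2 do not meet, the new inequality is strict
    everywhere and the polyhedron is unchanged.

    End.  Near a vertex of a smooth polyhedron the polyhedron is a simplicial
    cone whose edges are given by the dual basis; so the facets through the
    vertex are exactly the n tight walls ([wall_facet], [facet_wall],
    [smooth_delzant]). *)

(** * The dot product *)

Section Dot.
Variables (R : realType) (n : nat).
Implicit Types (u v w : 'rV[R]_n).

Lemma dotDl u v w : dot (u + v) w = dot u w + dot v w.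
Proof. by rewrite /dot -big_split; apply: eq_bigr => i _; rewrite mxE mulrDl. Qed.

Lemma dotZl (a : R) u w : dot (a *: u) w = a * dot u w.
Proof. by rewrite /dot mulr_sumr; apply: eq_bigr => i _; rewrite mxE mulrA. Qed.

Lemma dotC u v : dot u v = dot v u.
Proof. by apply: eq_bigr => i _; rewrite mulrC. Qed.

Lemma dotDr u v w : dot w (u + v) = dot w u + dot w v.
Proof. by rewrite dotC dotDl !(dotC w). Qed.

Lemma dotZr (a : R) u w : dot w (a *: u) = a * dot w u.
Proof. by rewrite dotC dotZl (dotC w). Qed.

Lemma dotNl u v : dot (- u) v = - dot u v.
Proof. by rewrite -scaleN1r dotZl mulN1r. Qed.

Lemma dotNr u v : dot u (- v) = - dot u v.
Proof. by rewrite dotC dotNl dotC. Qed.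

Lemma dotBr u v w : dot w (u - v) = dot w u - dot w v.
Proof. by rewrite dotDr dotNr. Qed.

Lemma dot0l v : dot 0 v = 0.
Proof. by rewrite -(scale0r 0) dotZl mul0r. Qed.

Lemma dot0r v : dot v 0 = 0.
Proof. by rewrite dotC dot0l. Qed.

Lemma dot_suml (I : finType) (A : {pred I}) (F : I -> 'rV[R]_n) v :
  dot (\sum_(i in A) F i) v = \sum_(i in A) dot (F i) v.
Proof. by apply: (big_morph (fun u => dot u v)) => [x y|]; rewrite ?dotDl ?dot0l. Qed.

Lemma dot_sumr (I : finType) (A : {pred I}) (F : I -> 'rV[R]_n) v :
  dot v (\sum_(i in A) F i) = \sum_(i in A) dot v (F i).
Proof. by apply: (big_morph (dot v)) => [x y|]; rewrite ?dotDr ?dot0r. Qed.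

Lemma dot_basis_vec i v : dot (basis_vec R i) v = v 0 i.
Proof.
rewrite /dot (bigD1 i) //= big1 ?addr0 => [|j nji]; first by rewrite mxE !eqxx mul1r.
by rewrite mxE (negbTE nji) mul0r.
Qed.

Lemma mulmx_dot m (A : 'M[R]_(m, n)) p (C : 'M[R]_(n, p)) i j :
  (A *m C) i j = dot (row i A) (row j C^T).
Proof. by rewrite mxE; apply: eq_bigr => k _; rewrite !mxE. Qed.

End Dot.

(** * Dimension and finite thresholds *)

Lemma uniform_threshold (R : realType) (I : finType) (Q : I -> R -> Prop) :
  (forall i, exists2 e : R, 0 < e & forall t, 0 <= t <= e -> Q i t) ->
  exists2 e : R, 0 < e & forall i t, 0 <= t <= e -> Q i t.
Proof.
move=> Qe.
suff [e e0 He] : exists2 e : R, 0 < e &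
    forall i t, i \in enum I -> 0 <= t <= e -> Q i t.
  by exists e => // i t; apply: He; rewrite mem_enum.
elim: (enum I) => [|i r [e e0 IH]]; first by exists 1.
have [e' e'0 He'] := Qe i; exists (Num.min e e'); first by rewrite lt_min e0.
move=> j t; rewrite inE le_min => /predU1P [->|jr] /and3P[t0 te te'].
  by apply: He'; rewrite t0.
by apply: IH => //; rewrite t0.
Qed.

Section Dimension.
Variables (R : realType) (n : nat).
Implicit Types (P Q : set 'rV[R]_n).

Lemma has_dim_directions P d (x0 x y : 'rV[R]_n) (A : 'M[R]_(d, n)) :
  (forall z, P z -> (z - x0 <= A)%MS) -> P x -> P y -> (x - y <= A)%MS.
Proof.
move=> PA Px Py; have -> : x - y = (x - x0) - (y - x0) by rewrite opprB addrA subrK.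
by apply: addmx_sub; [exact: PA | rewrite eqmx_opp; exact: PA].
Qed.

Lemma has_dim_mono P Q d e : P `<=` Q -> has_dim P d -> has_dim Q e -> (d <= e)%N.
Proof.
move=> PQ [x0 [A [Px0 freeA PA _]]] [y0 [C [Qy0 freeC _ QC]]].
rewrite -(eqP freeA) -(eqP freeC); apply: mxrankS; apply/row_subP => i.
rewrite -[row i A](addKr x0) addrC.
by apply: (has_dim_directions QC); apply: PQ.
Qed.

Lemma has_dim_inj P d e : has_dim P d -> has_dim P e -> d = e.
Proof. by move=> Pd Pe; apply/eqP; rewrite eqn_leq !(has_dim_mono _ Pd Pe, has_dim_mono _ Pe Pd). Qed.

End Dimension.

(** * Corners of bounded polyhedra *)

Section Polyhedra.
Variables (R : realType) (n : nat) (I : finType).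
Variables (l : I -> 'rV[R]_n) (b : I -> R).
Implicit Types (A : {set I}) (S : I) (x v d u : 'rV[R]_n).

Definition polyhedron A : set 'rV[R]_n :=
  [set x | forall S, S \in A -> dot (l S) x <= b S].

Definition tight S x := dot (l S) x = b S.

(** Vertices seen through the tight normals, which span the space; see
    [vertex_corner] and [corner_vertex] for the agreement with vertices as
    one-point faces. *)
Definition corner A v :=
  polyhedron A v /\
  forall d, (forall S, S \in A -> tight S v -> dot (l S) d = 0) -> d = 0.

Lemma small_move A x d : polyhedron A x ->
  (forall S, S \in A -> tight S x -> dot (l S) d <= 0) ->
  exists2 e : R, 0 < e & forall t, 0 <= t <= e -> polyhedron A (x + t *: d).
Proof.
move=> Px dP.
have [S|e e0 He] := @uniform_threshold R I (fun S t => S \in A -> dot (l S) (x + t *: d) <= b S).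
  have [SA|] := boolP (S \in A); last by exists 1.
  have := Px S SA; rewrite le_eqVlt => /predU1P [eqS|ltS].
    exists 1 => // t /andP[t0 _] _; rewrite dotDr dotZr eqS gerDl.
    by rewrite mulr_ge0_le0 // dP.
  exists ((b S - dot (l S) x) / (1 + `|dot (l S) d|)).
    by rewrite divr_gt0 ?subr_gt0 // ltr_pwDl.
  move=> t /andP[t0]; rewrite ler_pdivlMr ?ltr_pwDl // dotDr dotZr => tle _.
  have := ler_wpM2l t0 (ler_norm (dot (l S) d)); lra.
by exists e => // t te S SA; apply: He.
Qed.

(** The first wall met on leaving x inside all its walls: boundedness makes
    the exit time finite, and at that time a wall transverse to d is tight. *)
Lemma hit_wall A x d : bounded (polyhedron A) -> polyhedron A x -> d != 0 ->
  (forall S, S \in A -> tight S x -> dot (l S) d = 0) ->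
  exists2 t : R, 0 < t & polyhedron A (x + t *: d) /\
    exists2 S, S \in A & tight S (x + t *: d) /\ dot (l S) d != 0.
Proof.
move=> [M PM] Px d0 dP.
have [S0 /andP[S0A S0d]] : exists S, (S \in A) && (0 < dot (l S) d).
  apply/existsP; apply/contraT => /existsPn noS.
  case/eqP: d0; apply/rowP => i; rewrite mxE; apply/eqP/contraT => di0.
  have ray t : 0 <= t -> polyhedron A (x + t *: d).
    move=> t0 S SA; rewrite dotDr dotZr; apply: ler_wnDr; last exact: Px.
    by rewrite mulr_ge0_le0 // leNgt; have := noS S; rewrite SA.
  have M0 : 0 <= M by apply: le_trans (PM x Px i); rewrite normr_ge0.
  have absd : 0 < `|d 0 i| by rewrite normr_gt0.
  have c0 : 0 <= (2 * M + 1) / `|d 0 i| by rewrite divr_ge0 // addr_ge0 // mulr_ge0.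
  have := PM _ (ray _ c0) i; have := PM x Px i; rewrite !mxE.
  have := ler_normB (x 0 i + (2 * M + 1) / `|d 0 i| * d 0 i) (x 0 i).
  rewrite addrAC subrr add0r normrM (ger0_norm c0) divfK ?gt_eqF //; lra.
pose q S := (b S - dot (l S) x) / dot (l S) d.
pose PS S := (S \in A) && (0 < dot (l S) d).
have PS0 : PS S0 by rewrite /PS S0A.
case: (arg_minP q PS0) => S /andP[SA Sd] Smin.
have t0 : 0 < q S.
  rewrite divr_gt0 // subr_gt0 lt_neqAle Px // andbT.
  by apply/eqP => /(dP S SA) eqS; rewrite eqS ltxx in Sd.
exists (q S) => //; split.
  move=> T TA; rewrite dotDr dotZr.
  have [Td|Td] := ltP 0 (dot (l T) d).
    have := Smin T; rewrite /PS TA Td => /(_ isT).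
    rewrite {2}/q ler_pdivlMr //; lra.
  apply: ler_wnDr; last exact: Px.
  by rewrite mulr_ge0_le0 // ltW.
exists S => //; split; last by rewrite gt_eqF.
by rewrite /tight dotDr dotZr divfK ?gt_eqF // addrC subrK.
Qed.

(** Slide along a direction in all tight walls, chosen so as not to increase
    u, until a new wall becomes tight; the number of tight walls bounds the
    number of slides. *)
Lemma corner_below A u x : bounded (polyhedron A) -> polyhedron A x ->
  exists2 v, corner A v & dot u v <= dot u x.
Proof.
move=> bdA.
pose T x : {set I} := [set S in A | dot (l S) x == b S]%SET.
have [k] := ubnP (#|A| - #|T x|)%N; elim: k x => // k IH x /ltnSE lek Px.
have [nondeg|] := pselect (forall d, (forall S, S \in A -> tight S x -> dot (l S) d = 0) -> d = 0).
  by exists x.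
move/existsNP => [d /not_implyP[dP /eqP d0]].
wlog ud : d dP d0 / dot u d <= 0.
  move=> H; have [|ud] := leP (dot u d) 0; first exact: H.
  apply: (H (- d)); rewrite ?oppr_eq0 ?dotNr ?oppr_le0 //; last exact: ltW.
  by move=> S SA tS; rewrite dotNr dP ?oppr0.
have [t t0 [Py [S SA [tS Sd]]]] := hit_wall bdA Px d0 dP.
have [|v cv vle] := IH (x + t *: d) _ Py.
  apply: leq_trans lek; apply: ltn_sub2l; last first.
    apply: proper_card; apply/properP; split.
      apply/fintype.subsetP => U; rewrite !inE => /andP[UA /eqP tU].
      by rewrite UA dotDr dotZr tU dP // mulr0 addr0 eqxx.
    exists S; rewrite !inE SA; first by rewrite /= tS.
    by apply/eqP => /(dP S SA) /eqP; apply/negP.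
  apply: proper_card; apply/properP; split.
    by apply/fintype.subsetP => U; rewrite inE => /andP[].
  exists S => //; rewrite inE SA /=.
  by apply/eqP => /(dP S SA) /eqP; apply/negP.
exists v => //; apply: le_trans vle _; rewrite dotDr dotZr gerDl.
by rewrite mulr_ge0_le0 // ltW.
Qed.

(** A direction in all tight walls of v can be followed both ways, and one of
    them does not decrease u, so v would not be the only maximizer. *)
Lemma vertex_corner A v : vertex (polyhedron A) v -> corner A v.
Proof.
move=> [_ [u vu]].
have [Pv vmax] : max_face (polyhedron A) u v by rewrite -vu.
split=> // d dP; apply: contrapT => /eqP d0.
wlog ud : d dP d0 / 0 <= dot u d.
  move=> H; have [|ud] := leP 0 (dot u d); first exact: H.
  apply: (H (- d)); rewrite ?oppr_eq0 ?dotNr ?oppr_ge0 //; last exact: ltW.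
  by move=> S SA tS; rewrite dotNr dP ?oppr0.
have [|e e0 He] := @small_move A v d Pv; first by move=> S SA /(dP S SA)->.
have Pve : polyhedron A (v + e *: d) by apply: He; rewrite lexx ltW.
have : max_face (polyhedron A) u (v + e *: d).
  split=> // y Py; apply: le_trans (vmax y Py) _; rewrite dotDr dotZr lerDl.
  by rewrite mulr_ge0 // ltW.
rewrite -vu /= => /eqP; rewrite -subr_eq0 addrAC subrr add0r scaler_eq0.
by rewrite (negbTE d0) gt_eqF.
Qed.

(** The sum of the normals of the tight walls is maximal at a corner only. *)
Lemma corner_vertex A v : corner A v -> vertex (polyhedron A) v.
Proof.
move=> [Pv nondeg]; split; first by exists v.
pose T : {set I} := [set S in A | dot (l S) v == b S]%SET.
have uv : dot (\sum_(S in T) l S) v = \sum_(S in T) b S.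
  by rewrite dot_suml; apply: eq_bigr => S; rewrite inE => /andP[_ /eqP].
exists (\sum_(S in T) l S); apply/seteqP; split => [_ ->|x [Px xmax]].
  split=> // y Py; rewrite uv dot_suml; apply: ler_sum => S.
  by rewrite inE => /andP[SA _]; apply: Py.
apply/eqP; rewrite -subr_eq0; apply/eqP/nondeg => S SA tS.
have := xmax v Pv; rewrite uv dot_suml => sumle.
apply/eqP; rewrite dotBr tS subr_eq0.
have ST : S \in T by rewrite inE SA tS eqxx.
have /eqP : \sum_(U in T) (b U - dot (l U) x) = 0.
  apply/eqP; rewrite eq_le sumrB subr_le0 sumle subr_ge0.
  by apply: ler_sum => U; rewrite inE => /andP[UA _]; apply: Px.
rewrite psumr_eq0 => [/allP /(_ S)|U]; last first.
  by rewrite inE => /andP[UA _]; rewrite subr_ge0 Px.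
by rewrite mem_index_enum ST subr_eq0 eq_sym => /(_ isT).
Qed.

End Polyhedra.

(** * Smooth polyhedra and shaving *)

Section SmoothPolyhedra.
Variables (R : realType) (n : nat) (I : finType).
Variables (l : I -> 'rV[R]_n) (b : I -> R).
Implicit Types (A : {set I}) (S : I) (x v d u : 'rV[R]_n).

(** The n walls through v, numbered by f, and their normals as the rows of a
    unimodular integer matrix.  Demanding that every tight inequality be listed
    once makes the property one of the list A, not of the polyhedron alone: no
    redundant inequality is ever tight, and none is repeated. *)
Definition smooth_frame A v (f : 'I_n -> I) (W : 'M[int]_n) :=
  [/\ injective f,
      forall S, (S \in A /\ tight l b S v) <-> exists i, S = f i,
      forall i, l (f i) = map_mx intr (row i W)
    & W \in unitmx].

Definition smooth A :=
  [/\ bounded (polyhedron l b A),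
      exists x, forall S, S \in A -> dot (l S) x < b S
    & forall v, corner l b A v -> exists f W, smooth_frame A v f W].

Lemma dual_basis A v f W : smooth_frame A v f W ->
  exists D : 'I_n -> 'rV[R]_n,
    (forall i j, dot (l (f i)) (D j) = (i == j)%:R) /\
    (forall u, u = \sum_i dot u (D i) *: l (f i)).
Proof.
move=> [_ _ lW unitW].
pose L : 'M[R]_n := map_mx intr W; pose L' : 'M[R]_n := map_mx intr (invmx W).
have rowL i : row i L = l (f i) by rewrite lW map_row.
have LL' : L *m L' = 1%:M by rewrite -map_mxM mulmxV // map_mx1.
exists (fun j => row j L'^T); split => [i j|u].
  by rewrite -rowL -mulmx_dot LL' mxE.
rewrite -{1}[u]mulmx1 -(mulmx1C LL') mulmxA mulmx_sum_row.
by apply: eq_bigr => i _; rewrite mulmx_dot row_id rowL.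
Qed.

Lemma row_op_unit (W : 'M[int]_n) (i j : 'I_n) : i != j ->
  W \in unitmx -> (1%:M + delta_mx i j) *m W \in unitmx.
Proof.
move=> ij unitW; rewrite unitmx_mul unitW andbT.
have : (1%:M + delta_mx i j) *m (1%:M - delta_mx i j) = 1%:M :> 'M[int]_n.
  rewrite mulmxDl mul1mx mulmxBr mulmx1 mul_delta_mx_0 1?eq_sym //.
  by rewrite subr0 subrK.
by case/mulmx1_unit.
Qed.

Lemma row_row_op (W : 'M[int]_n) (i j k : 'I_n) :
  row k ((1%:M + delta_mx i j) *m W) = row k W + row j W *+ (k == i).
Proof.
rewrite mulmxDl mul1mx linearD /= row_mul; congr (_ + _).
rewrite [row k (delta_mx _ _)]rowE mul_delta_mx_cond.
by case: (k == i); rewrite ?mulr0n ?mul0mx // !mulr1n -rowE.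
Qed.

(** The new corner lies inside an edge of the old polyhedron, one end p of
    which is cut off, hence lies on both walls S1 and S2.  Of the n walls at p
    the edge lies in all but one, and the missing one must be S1 or S2, since
    no point of both walls survives the cut. *)
Lemma shaved_corner A S1 S2 S (v : 'rV[R]_n) (eps : R) :
  smooth A -> S1 \in A -> S2 \in A -> S1 != S2 -> S \notin A ->
  l S = l S1 + l S2 -> 0 < eps -> b S = b S1 + b S2 - eps ->
  (forall p, corner l b A p -> ~ (tight l b S1 p /\ tight l b S2 p) ->
     dot (l S) p < b S) ->
  corner l b (S |: A) v -> tight l b S v ->
  exists f W, smooth_frame (S |: A) v f W.
Proof.
move=> [bdA _ cornA] S1A S2A S12 SA lS eps0 bS cut [Pv' nondeg] tSv.
have Pv : polyhedron l b A v by move=> T TA; apply: Pv'; rewrite !inE TA orbT.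
have notboth x : dot (l S) x <= b S -> ~ (tight l b S1 x /\ tight l b S2 x).
  by move=> le [t1 t2]; move: le; rewrite lS dotDl t1 t2 bS; lra.
have [d dP d0] : exists2 d, (forall T, T \in A -> tight l b T v -> dot (l T) d = 0) & d != 0.
  apply: contrapT => nod; have cv : corner l b A v.
    split=> // d dP; apply: contrapT => /eqP d0; apply: nod.
    by exists d.
  have /notboth /(cut v cv) : dot (l S) v <= b S by rewrite tSv.
  by rewrite tSv ltxx.
have killed e : (forall T, T \in A -> tight l b T v -> dot (l T) e = 0) ->
    dot (l S) e = 0 -> e = 0.
  by move=> eA eS; apply: nondeg => T; rewrite !inE => /predU1P [->|] //; apply: eA.
wlog Sd : d dP d0 / 0 < dot (l S) d.
  move=> H; have [|Sd|/eqP Sd] := ltgtP 0 (dot (l S) d); first exact: H.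
    apply: (H (- d)); rewrite ?oppr_eq0 ?dotNr ?oppr_gt0 //.
    by move=> T TA tT; rewrite dotNr dP ?oppr0.
  by case/eqP: d0; apply: killed => //; apply/eqP; rewrite eq_sym.
pose c e := dot (l S) e / dot (l S) d.
have line e : (forall T, T \in A -> tight l b T v -> dot (l T) e = 0) -> e = c e *: d.
  move=> eP; apply/eqP; rewrite -subr_eq0; apply/eqP/killed => [T TA tT|].
    by rewrite dotBr dotZr eP // dP // mulr0 subr0.
  by rewrite dotBr dotZr divfK ?gt_eqF // subrr.
have [t t0 [Pp [U UA [tU Ud]]]] := hit_wall bdA Pv d0 dP.
set p := v + t *: d in Pp tU.
have tightvp T : T \in A -> tight l b T v -> tight l b T p.
  by move=> TA tT; rewrite /tight dotDr dotZr dP // mulr0 addr0.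
have cp : corner l b A p.
  split=> // e eP; have eline : e = c e *: d.
    by apply: line => T TA tT; apply: eP => //; apply: tightvp.
  have := eP U UA tU; rewrite eline dotZr => /eqP.
  by rewrite mulf_eq0 (negbTE Ud) orbF => /eqP ->; rewrite scale0r.
have [t1 t2] : tight l b S1 p /\ tight l b S2 p.
  apply: contrapT => /(cut p cp); rewrite dotDr dotZr tSv.
  by have := mulr_gt0 t0 Sd; lra.
have [f [W frame]] := cornA p cp.
have [finj fT lW unitW] := frame.
have [D [dualD _]] := dual_basis frame.
have fA i : f i \in A by case: (fT (f i)) => _ [|//]; exists i.
have tightf T : T \in A -> tight l b T v -> exists i, T = f i.
  by move=> TA tT; apply/fT; split=> //; apply: tightvp.
(* two missing walls would put two dual vectors on the line of d *)
have only_one i j : ~ tight l b (f i) v -> ~ tight l b (f j) v -> i = j.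
  move=> ni nj; apply: contrapT => /eqP ij.
  have lineD k : ~ tight l b (f k) v -> D k = c (D k) *: d.
    move=> nk; apply: line => T TA tT; have [m Tm] := tightf T TA tT.
    rewrite Tm dualD; case: eqVneq => // mk.
    by case: nk; rewrite -mk -Tm.
  have := dualD i j; rewrite (negbTE ij) (lineD j nj) dotZr => /eqP.
  rewrite mulf_eq0 => /orP [] /eqP H0.
    have := dualD j j; rewrite (lineD j nj) H0 scale0r dot0r eqxx => /eqP.
    by rewrite eq_sym oner_eq0.
  have := dualD i i; rewrite (lineD i ni) dotZr H0 mulr0 eqxx => /eqP.
  by rewrite eq_sym oner_eq0.
(* by symmetry v misses the wall S1; in the row operation the row of S1
   becomes the sum of the rows of S1 and S2 *)
clear cut; wlog n1 : S1 S2 S1A S2A S12 lS bS t1 t2 notboth / ~ tight l b S1 v.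
  move=> H; have [tS1|] := pselect (tight l b S1 v); last exact: (H S1 S2).
  apply: (H S2 S1) => //; rewrite 1?eq_sym // 1?(addrC (l S2)) // 1?(addrC (b S2)) //.
  - by move=> x /notboth nx []; move=> ? ?; apply: nx.
  - by move=> tS2; apply: (notboth v); rewrite ?tSv.
have [i1 e1] : exists i, S1 = f i by apply/fT.
have [i2 e2] : exists i, S2 = f i by apply/fT.
have i12 : i1 != i2 by apply: contraNneq S12 => ei; rewrite e1 e2 ei.
have fS i : f i != S by apply: contraNneq SA => <-.
exists (fun i => if i == i1 then S else f i), ((1%:M + delta_mx i1 i2) *m W).
split.
- move=> i j /=; case: eqVneq => [->|ni]; case: eqVneq => [->|nj] //.
  + by move/eqP; rewrite eq_sym (negbTE (fS j)).
  + by move/eqP; rewrite (negbTE (fS i)).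
  + exact: finj.
- move=> T; split=> [[]|[i ->]].
    rewrite !inE => /predU1P [->|TA] tT; first by exists i1; rewrite eqxx.
    have [i Ti] := tightf T TA tT; exists i; case: eqVneq => // ii.
    by case: n1; rewrite e1 -ii -Ti.
  case: eqVneq => [_|ni]; first by rewrite setU11.
  split; first by rewrite !inE fA orbT.
  apply: contrapT => nti; case/eqP: ni; apply: only_one => //.
  by rewrite -e1.
- move=> i; rewrite row_row_op map_mxD -lW; case: eqVneq => [->|ni].
    by rewrite mulr1n -lW lS e1 e2.
  by rewrite mulr0n raddf0 addr0.
- exact: row_op_unit.
Qed.

(** A strictly interior point survives because some corner does: one where
    the normal of S1 is below its value at the old interior point, hence off
    the wall S1; a point near it, on the way to the old one, is interior. *)
Lemma smooth_shave A S1 S2 S (eps : R) :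
  smooth A -> S1 \in A -> S2 \in A -> S1 != S2 -> S \notin A ->
  l S = l S1 + l S2 -> 0 < eps -> b S = b S1 + b S2 - eps ->
  (forall v, vertex (polyhedron l b A) v ->
     ~ (tight l b S1 v /\ tight l b S2 v) -> dot (l S) v < b S) ->
  smooth (S |: A).
Proof.
move=> smA S1A S2A S12 SA lS eps0 bS cutv.
have cut p : corner l b A p -> ~ (tight l b S1 p /\ tight l b S2 p) -> dot (l S) p < b S.
  by move/corner_vertex; apply: cutv.
have [[M PM] [x0 x0int] cornA] := smA.
have sub x : polyhedron l b (S |: A) x -> polyhedron l b A x.
  by move=> Px T TA; apply: Px; rewrite !inE TA orbT.
split.
- by exists M => x /sub; apply: PM.
- have Px0 : polyhedron l b A x0 by move=> T /x0int /ltW.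
  have [p cp ple] := corner_below (l S1) (ex_intro _ M PM) Px0.
  have Sp : dot (l S) p < b S.
    apply: cut => // -[t1 _]; move: ple; rewrite t1.
    by have := x0int S1 S1A; lra.
  have [||e e0 He] := @small_move R n I l b [set S] p (x0 - p).
  + by move=> T; rewrite inE => /eqP ->; apply: ltW.
  + by move=> T; rewrite inE => /eqP -> tS; rewrite tS ltxx in Sp.
  (* half of the threshold, and at most 1/2 so that the weight of p is kept *)
  pose t := Num.min e 1 / 2.
  have m0 : 0 < Num.min e 1 by rewrite lt_min e0 ltr01.
  have [me m1] : Num.min e 1 <= e /\ Num.min e 1 <= 1 by split; rewrite ge_min lexx ?orbT.
  have t0 : 0 < t by rewrite divr_gt0.
  have te : t <= e by rewrite /t; lra.
  have t1 : t < 1 by rewrite /t; lra.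
  exists (p + t *: (x0 - p)) => T; rewrite inE => /orP[/set1P ->|TA].
    have : polyhedron l b [set S] (p + e *: (x0 - p)) by apply: He; rewrite ltW // lexx.
    move=> /(_ S (set11 S)); rewrite !dotDr !dotZr => leS.
    have : t * (dot (l S) p + e * dot (l S) (x0 - p)) <= t * b S by rewrite ler_pM2l.
    have : (e - t) * dot (l S) p < (e - t) * b S.
      rewrite ltr_pM2l //; rewrite subr_gt0 /t; lra.
    rewrite -(ltr_pM2l e0); nra.
  have := x0int T TA; have := proj1 cp T TA; rewrite dotDr dotZr dotBr.
  by move=> pT xT; nra.
- move=> v cv; have [Pv nondeg] := cv.
  have [tS|ntS] := pselect (tight l b S v); first exact: (shaved_corner smA S1A S2A S12 SA lS eps0 bS).
  have cAv : corner l b A v.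
    split=> [|d dP]; first exact: sub.
    by apply: nondeg => T; rewrite !inE => /predU1P [->|] //; apply: dP.
  have [f [W [finj fT lW unitW]]] := cornA v cAv.
  exists f, W; split=> // T; rewrite -fT !inE; split=> [[/predU1P [->|TA] tT]|[-> tT]] //.
  by rewrite orbT.
Qed.

(** * Facets of smooth polyhedra *)

Lemma smooth_has_dim A : smooth A -> has_dim (polyhedron l b A) n.
Proof.
move=> [_ [x0 x0int] _].
have Px0 : polyhedron l b A x0 by move=> T /x0int /ltW.
have [i|e e0 He] := @uniform_threshold R 'I_n
    (fun i t => polyhedron l b A (x0 + t *: basis_vec R i)).
  by apply: small_move => // T /x0int /[swap] ->; rewrite ltxx.
exists x0, (e%:M); split=> //.
- by rewrite row_free_unit unitmxE det_scalar unitfE expf_neq0 // gt_eqF.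
- move=> i; rewrite -scalemx1 linearZ /= row1; apply: He.
  by rewrite lexx ltW.
- move=> x _; apply: submx_full; rewrite row_full_unit unitmxE det_scalar.
  by rewrite unitfE expf_neq0 // gt_eqF.
Qed.

(** Near a smooth corner the polyhedron is the cone on which the n independent
    walls hold, so the dual basis gives its edges. *)
Lemma edge_step A v f W (D : 'I_n -> 'rV[R]_n) :
  polyhedron l b A v -> smooth_frame A v f W ->
  (forall i j, dot (l (f i)) (D j) = (i == j)%:R) ->
  exists2 e : R, 0 < e & forall j, polyhedron l b A (v - e *: D j).
Proof.
move=> Pv [_ fT _ _] dualD.
have [j|e e0 He] := @uniform_threshold R 'I_n
    (fun j t => polyhedron l b A (v + t *: (- D j))).
  apply: small_move => // T TA tT; have [i ->] : exists i, T = f i by apply/fT.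
  by rewrite dotNr dualD oppr_le0 ler0n.
by exists e => // j; rewrite -scalerN; apply: He; rewrite lexx ltW.
Qed.

Definition wall A S : set 'rV[R]_n := max_face (polyhedron l b A) (l S).

Lemma wallE A S v x : polyhedron l b A v -> S \in A -> tight l b S v ->
  wall A S x <-> polyhedron l b A x /\ tight l b S x.
Proof.
move=> Pv SA tS; split=> [[Px xmax]|[Px tx]]; split=> //.
  by apply/eqP; rewrite /tight eq_le Px // -tS xmax.
by move=> y Py; rewrite tx Py.
Qed.

(** The wall through v contains the edges from v dual to the other n - 1 walls,
    and these span its directions. *)
Lemma wall_facet A v f W (i : 'I_n) : smooth A -> corner l b A v ->
  smooth_frame A v f W -> facets (polyhedron l b A) (wall A (f i)).
Proof.
move=> smA [Pv nondeg] frame; have [finj fT lW unitW] := frame.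
have [D [dualD _]] := dual_basis frame.
have [e e0 He] := edge_step Pv frame dualD.
have fiP k : f k \in A /\ tight l b (f k) v by apply/fT; exists k.
have wallP x := wallE x Pv (proj1 (fiP i)) (proj2 (fiP i)).
have wv : wall A (f i) v by apply/wallP; split=> //; case: (fiP i).
split; first by split; [exists v | exists (l (f i))].
have n0 : n = n.-1.+1 by rewrite prednK // (leq_ltn_trans _ (ltn_ord i)).
exists n.-1; split; first by rewrite -n0; apply: smooth_has_dim.
pose A' : 'M[R]_(n.-1, n) := \matrix_(j, k) (- e *: D (lift i j)) 0 k.
have rowA' j : row j A' = - (e *: D (lift i j)).
  by rewrite -scaleNr; apply/rowP => k; rewrite !mxE.
pose C : 'M[R]_(n, n.-1) := - e^-1 *: (\matrix_(j, k) l (f (lift i j)) 0 k)^T.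
have rowC u j : (u *m C) 0 j = - e^-1 * dot (l (f (lift i j))) u.
  rewrite /C -scalemxAr mxE mulmx_dot trmxK row_id dotC; congr (_ * dot _ _).
  by apply/rowP => k; rewrite !mxE.
exists v, A'; split=> //.
- apply/row_freeP; exists C; apply/row_matrixP => j; rewrite row_mul rowA' row1.
  apply/rowP => k; rewrite rowC !mxE eqxx /= dotNr dotZr dualD.
  rewrite mulrNN mulrA mulVf ?(gt_eqF e0) // mul1r (inj_eq lift_inj) eq_sym //.
- move=> j; rewrite rowA'; apply/wallP; split; first exact: He.
  rewrite /tight dotDr dotNr dotZr dualD (negbTE (neq_lift _ _)) mulr0 subr0.
  by case: (fiP i).
- move=> x /wallP [Px tx]; apply/submxP; exists ((x - v) *m C).
  apply/eqP; rewrite -subr_eq0; apply/eqP/nondeg => T TA tT.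
  have [k ->] : exists k, T = f k by apply/fT.
  rewrite dotBr mulmx_sum_row dot_sumr.
  rewrite (eq_bigr (fun j => dot (l (f (lift i j))) (x - v) * (k == lift i j)%:R)).
    have [j ->|->] := unliftP i k.
      rewrite (bigD1 j) //= eqxx mulr1 big1 ?addr0 => [|m mj].
        by rewrite dotBr subrr.
      by rewrite (inj_eq lift_inj) eq_sym (negbTE mj) mulr0.
    rewrite big1 ?subr0 => [|j _]; last by rewrite (negbTE (neq_lift _ _)) mulr0.
    by rewrite dotBr tx; case: (fiP i) => _ ->; rewrite subrr.
  move=> j _; rewrite rowA' dotZr dotNr dotZr dualD rowC mulrN !mulNr opprK.
  by rewrite mulrACA mulVf ?(gt_eqF e0) // mul1r.
Qed.

(** With u a combination of the wall normals with coordinates c_i >= 0, the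
    deficit of x from the maximum u.v is the sum of the c_i times the slacks
    of x in the wall inequalities, and it vanishes termwise. *)
Lemma max_face_at A v f W (D : 'I_n -> 'rV[R]_n) u x :
  polyhedron l b A v -> smooth_frame A v f W ->
  (forall u, u = \sum_i dot u (D i) *: l (f i)) ->
  (forall i, 0 <= dot u (D i)) ->
  max_face (polyhedron l b A) u x <->
  polyhedron l b A x /\ forall i, dot u (D i) != 0 -> tight l b (f i) x.
Proof.
move=> Pv [_ fT _ _] expand u_ge0.
have fiP i : f i \in A /\ tight l b (f i) v by apply/fT; exists i.
have gap y : dot u v - dot u y = \sum_i dot u (D i) * (b (f i) - dot (l (f i)) y).
  rewrite -dotBr {1}(expand u) dot_suml; apply: eq_bigr => i _.
  by rewrite dotZl dotBr (proj2 (fiP i)).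
have term_ge0 y i : polyhedron l b A y -> 0 <= dot u (D i) * (b (f i) - dot (l (f i)) y).
  by move=> Py; rewrite mulr_ge0 // subr_ge0 Py //; case: (fiP i).
split=> [[Px xmax]|[Px xT]]; split=> //.
- move=> i ci; have /eqP : dot u v - dot u x = 0.
    apply/eqP; rewrite eq_le subr_le0 xmax //= gap.
    by apply: sumr_ge0 => j _; apply: term_ge0.
  rewrite gap psumr_eq0 => [/allP /(_ i)|j _]; last exact: term_ge0.
  by rewrite mem_index_enum mulf_eq0 (negbTE ci) subr_eq0 => /(_ isT) /eqP.
- move=> y Py; have -> : dot u x = dot u v.
    apply/eqP; rewrite eq_sym -subr_eq0 gap big1 // => i _.
    by have [->|/xT ->] := eqVneq (dot u (D i)) 0; rewrite ?mul0r // subrr mulr0.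
  by rewrite -subr_ge0 gap sumr_ge0 // => j _; apply: term_ge0.
Qed.

(** The normals l S1 and l S2 annihilate the directions of P, and the pairing
    with D1 and D2 shows that they are independent. *)
Lemma has_dim_two_walls (P : set 'rV[R]_n) (d : nat) S1 S2 (D1 D2 : 'rV[R]_n) :
  has_dim P d -> (forall x, P x -> tight l b S1 x /\ tight l b S2 x) ->
  dot (l S1) D1 = 1 -> dot (l S1) D2 = 0 ->
  dot (l S2) D1 = 0 -> dot (l S2) D2 = 1 -> (d + 2 <= n)%N.
Proof.
move=> [x0 [A [Px0 freeA PA _]]] Pt d11 d12 d21 d22.
pose C := col_mx (l S1) (l S2).
have freeC : row_free C.
  apply/row_freeP; exists (row_mx D1^T D2^T).
  rewrite mul_col_row [1%:M]scalar_mx_block.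
  by congr block_mx; apply/matrixP => i j; rewrite !ord1 mulmx_dot trmxK !row_id
     ?d11 ?d12 ?d21 ?d22 !mxE.
have kill i S : (forall x, P x -> tight l b S x) -> dot (l S) (row i A) = 0.
  move=> PS; have := PS _ (PA i); rewrite /tight dotDr PS // => /eqP.
  by rewrite -subr_eq0 addrAC subrr add0r => /eqP.
have : A *m C^T = 0.
  rewrite tr_col_mx mul_mx_row -row_mx0.
  by congr row_mx; apply/matrixP => i j; rewrite ord1 mulmx_dot trmxK row_id dotC kill ?mxE //
     => x /Pt [].
by move/mulmx0_rank_max; rewrite mxrank_tr (eqP freeA) (eqP freeC).
Qed.

(** A facet through v is cut out by a functional with nonnegative coordinates
    in the n wall normals; the facet lies on every wall whose coordinate is
    positive.  No positive coordinate gives the whole polyhedron and two of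
    them give codimension at least 2. *)
Lemma facet_wall A v f W F : smooth A -> corner l b A v ->
  smooth_frame A v f W -> facets (polyhedron l b A) F -> F v ->
  exists i, F = wall A (f i).
Proof.
move=> smA [Pv nondeg] frame [[_ [u Fu]] [d [Pd Fd]]] Fv.
have [finj fT lW unitW] := frame.
have [D [dualD expand]] := dual_basis frame.
have [e e0 He] := edge_step Pv frame dualD.
have fiP i : f i \in A /\ tight l b (f i) v by apply/fT; exists i.
have u_ge0 i : 0 <= dot u (D i).
  move: Fv; rewrite Fu => -[_ /(_ _ (He i))].
  by rewrite dotBr dotZr gerBl pmulr_rge0.
have FP x := max_face_at x Pv frame expand u_ge0.
have dn := has_dim_inj Pd (smooth_has_dim smA).
have [i ci] : exists i, dot u (D i) != 0.
  apply: contrapT => /forallNP u0.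
  have FP' : polyhedron l b A `<=` F.
    move=> x Px; rewrite Fu; apply/FP; split=> // i /negP.
    by move=> ni; case: (u0 i); apply/negP.
  by have := has_dim_mono FP' Pd Fd; rewrite ltnn.
have uniq_i j : dot u (D j) != 0 -> j = i.
  move=> cj; apply: contrapT => /eqP ji.
  have : (d + 2 <= n)%N.
    apply: (@has_dim_two_walls F d (f i) (f j) (D i) (D j)) => //.
    - by move=> x; rewrite Fu => /FP [_ xt]; split; apply: xt.
    - by rewrite dualD eqxx.
    - by rewrite dualD eq_sym (negbTE ji).
    - by rewrite dualD (negbTE ji).
    - by rewrite dualD eqxx.
  by rewrite -dn addn2 ltnn.
exists i; rewrite Fu; apply/seteqP; split=> x.
- move/FP => [Px /(_ i ci) tx].
  by apply/(wallE x Pv); case: (fiP i).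
- have [fiA tfi] := fiP i; move/(wallE x Pv fiA tfi) => [Px tx].
  by apply/FP; split=> // j /uniq_i ->.
Qed.

Lemma unitmx_Z_basis (W : 'M[int]_n) : W \in unitmx -> Z_basis (fun i => row i W).
Proof.
move=> unitW z; exists (z *m invmx W); split.
  by rewrite -mulmx_sum_row mulmxKV.
by move=> c ->; rewrite -mulmx_sum_row mulmxK.
Qed.

Lemma smooth_delzant A : smooth A -> delzant (polyhedron l b A).
Proof.
move=> smA; split; [split|exact: smooth_has_dim|].
- by case: smA.
- exists #|A|, (fun i => l (enum_val i)), (fun i => b (enum_val i)).
  apply/seteqP; split=> x Px => [i|S SA]; first by apply: Px; apply: enum_valP.
  by rewrite -(enum_rankK_in SA SA).
move=> v /vertex_corner cv; have [Pv _] := cv.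
have [_ _ /(_ v cv) [f [W frame]]] := smA.
have [finj fT lW unitW] := frame.
have [D [dualD _]] := dual_basis frame.
have [e e0 He] := edge_step Pv frame dualD.
have fiP i : f i \in A /\ tight l b (f i) v by apply/fT; exists i.
have wallP i x := wallE x Pv (proj1 (fiP i)) (proj2 (fiP i)).
exists (fun i => wall A (f i)), (fun i => row i W); split.
- split.
  + move=> i _; split; first exact: (wall_facet i smA cv frame).
    by apply/wallP; split=> //; case: (fiP i).
  + move=> i j _ _ eqw; apply: contrapT => /eqP ij.
    (* the edge leaving wall j stays on wall i *)
    have : wall A (f i) (v - e *: D j).
      apply/wallP; split; first exact: He.
      by rewrite /tight dotBr dotZr dualD (negbTE ij) mulr0 subr0; case: (fiP i).
    rewrite eqw => /wallP [_]; rewrite /tight dotBr dotZr dualD eqxx mulr1.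
    by rewrite (proj2 (fiP j)); lra.
  + move=> F [facF Fv]; have [i ->] := facet_wall smA cv frame facF Fv.
    by exists i.
- move=> i; exists (l (f i)).
    split=> //; apply/eqP => l0; have := dualD i i.
    by rewrite l0 dot0l eqxx => /eqP; rewrite eq_sym oner_eq0.
  by exists 1; rewrite ?oner_neq0 // scale1r lW.
- exact: unitmx_Z_basis.
Qed.

End SmoothPolyhedra.

(** * Faces of nestohedra *)

Section NestohedronFaces.
Variables (R : realType) (n : nat).
Implicit Types (B : {set {set 'I_n.+1}}) (S T U : {set 'I_n.+1}).
Implicit Types (x y : 'rV[R]_n.+1).

Definition mass S x : R := \sum_(i in S) x 0 i.

(** The minimum of mass S over the nestohedron, each summand simplex inside S
    contributing its total mass 1 and each other one contributing 0. *)
Definition min_mass B S : R := \sum_(T in B) (T \subset S)%:R.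

Lemma simplex_coord T y : conv_family T (@basis_vec R n.+1) y ->
  [/\ forall i, 0 <= y 0 i, forall i, i \notin T -> y 0 i = 0 & mass T y = 1].
Proof.
move=> [w [w0 w1 yE]].
have yi i : y 0 i = if i \in T then w i else 0.
  rewrite yE summxE; case: ifP => iT.
    rewrite (bigD1 i) //= !mxE !eqxx mulr1 big1 ?addr0 // => j /andP[_ ji].
    by rewrite !mxE eq_sym (negbTE ji) andbF mulr0.
  rewrite big1 // => j jT; rewrite !mxE.
  by case: (eqVneq i j) iT => [->|_]; rewrite ?jT // andbF mulr0.
split=> [i|i /negbTE iT|]; rewrite ?yi ?iT //.
  by case: ifP => // /w0.
by rewrite -w1; apply: eq_bigr => i iT; rewrite yi iT.
Qed.

Lemma basis_vec_simplex T i : i \in T -> conv_family T (@basis_vec R n.+1) (basis_vec R i).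
Proof.
move=> iT; exists (fun j => (j == i)%:R); split=> [j _||]; first exact: ler0n.
  by rewrite (bigD1 i) //= eqxx big1 ?addr0 // => j /andP[_ /negbTE ->].
by rewrite (bigD1 i) //= eqxx scale1r big1 ?addr0 // => j /andP[_ /negbTE ->]; rewrite scale0r.
Qed.

Lemma mass_sum B S (y : {set 'I_n.+1} -> 'rV[R]_n.+1) :
  mass S (\sum_(T in B) y T) = \sum_(T in B) mass S (y T).
Proof. by rewrite /mass exchange_big; apply: eq_bigr => i _; rewrite summxE. Qed.

Lemma mass_simplex_lb S T y : conv_family T (@basis_vec R n.+1) y ->
  (T \subset S)%:R <= mass S y.
Proof.
move=> /simplex_coord [y0 _ yT]; have [/fintype.subsetP TS|_] := boolP (T \subset S); last first.
  by apply: sumr_ge0.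
rewrite -yT /mass [leRHS](bigID (mem T)) /= ler_wpDr ?sumr_ge0 //.
rewrite le_eqVlt; apply/orP; left; apply/eqP; apply: eq_bigl => i /=.
by case: (boolP (i \in T)) => [/TS ->|_]; rewrite ?andbF.
Qed.

Lemma mass_lb B S x : nestohedron B x -> min_mass B S <= mass S x.
Proof.
by move=> [y yP ->]; rewrite mass_sum; apply: ler_sum => T /yP; apply: mass_simplex_lb.
Qed.

(** Choosing one basis vector in each summand simplex gives the points of the
    nestohedron used below; they suffice to witness minima of mass. *)
Definition selection (g : {set 'I_n.+1} -> 'I_n.+1) B := forall T, T \in B -> g T \in T.

Definition select_point B (g : {set 'I_n.+1} -> 'I_n.+1) : 'rV[R]_n.+1 :=
  \sum_(T in B) basis_vec R (g T).

Lemma select_point_in B g : selection g B -> nestohedron B (select_point B g).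
Proof.
by move=> gB; exists (fun T => basis_vec R (g T)) => // T /gB; apply: basis_vec_simplex.
Qed.

Lemma mass_select_point B g S : mass S (select_point B g) = \sum_(T in B) (g T \in S)%:R.
Proof.
rewrite mass_sum; apply: eq_bigr => T _; rewrite /mass.
have [gS|gS] := boolP (g T \in S).
  rewrite (bigD1 (g T)) //= mxE !eqxx big1 ?addr0 // => i /andP[_ ig].
  by rewrite mxE (negbTE ig) andbF.
rewrite big1 // => i iS; rewrite mxE.
by case: (eqVneq i (g T)) gS => [<-|_]; rewrite ?iS // andbF.
Qed.

(** Selecting outside S whenever possible attains the lower bound. *)
Lemma avoiding_selection B S : finset.set0 \notin B ->
  exists2 g, selection g B & forall T, T \in B -> (g T \in S) = (T \subset S).
Proof.
move=> B0.
pose g T := if [pick i in T :\: S] is Some i then i else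
            if [pick i in T] is Some i then i else ord0.
have gP T : T \in B -> g T \in T /\ (g T \in S) = (T \subset S).
  move=> TB; rewrite /g; case: pickP => [i|none].
    rewrite inE => /andP[iS iT]; split=> //; rewrite (negbTE iS).
    by apply/esym/negbTE/fintype.subsetPn; exists i.
  have TS : T \subset S.
    apply/fintype.subsetP => i iT; apply: contraT => iS.
    by have := none i; rewrite inE iS iT.
  case: pickP => [i iT|T0]; first by rewrite TS (fintype.subsetP TS).
  case/negP: B0; suff <- : T = finset.set0 by [].
  by apply/setP => i; rewrite T0 inE.
by exists g => T /gP [].
Qed.

Lemma nesto_facetE B S x : finset.set0 \notin B ->
  nesto_facet B S x <-> nestohedron B x /\ mass S x = min_mass B S.
Proof.
move=> B0; split=> [[Px xmin]|[Px xm]]; split=> //.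
  apply/eqP; rewrite eq_le mass_lb // andbT.
  have [g gB gS] := avoiding_selection S B0.
  have := xmin _ (select_point_in gB); rewrite -/(mass S x) -/(mass S _).
  rewrite mass_select_point /min_mass => H; apply: (le_trans H).
  by apply: ler_sum => T TB; rewrite gS.
by move=> y /(mass_lb S); rewrite -xm.
Qed.

Lemma nesto_facet_face B S : finset.set0 \notin B -> faces (@nestohedron R n B) (nesto_facet B S).
Proof.
move=> B0; split.
  have [g gB gS] := avoiding_selection S B0; exists (select_point B g).
  apply/(nesto_facetE _ _ B0); split; first exact: select_point_in.
  by rewrite mass_select_point; apply: eq_bigr => T TB; rewrite gS.
exists (- \sum_(i in S) basis_vec R i).
have massE x : dot (- \sum_(i in S) basis_vec R i) x = - mass S x.
  by rewrite dotNl dot_suml; congr (- _); apply: eq_bigr => i _; rewrite dot_basis_vec.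
by apply/seteqP; split=> x [Px xm]; split=> // y /xm; rewrite !massE lerN2.
Qed.

Lemma nestohedron_face B : finset.set0 \notin B ->
  faces (@nestohedron R n B) (nestohedron B).
Proof.
move=> B0; split; first by have [x [Px _]] := proj1 (nesto_facet_face finset.set0 B0); exists x.
by exists 0; apply/seteqP; split=> [x Px|x []] //; split=> // y _; rewrite !dot0l.
Qed.

(** The simplex of the whole ground set can put its mass on any element, in
    particular on one outside S. *)
Lemma nesto_facet_not_sub B S T : finset.set0 \notin B -> [set: 'I_n.+1]%SET \in B ->
  T != [set: 'I_n.+1]%SET -> ~~ (T \subset S) ->
  ~ (@nesto_facet R n B S `<=` nesto_facet B T).
Proof.
move=> B0 BT TnT /fintype.subsetPn [i iT iS] sub.
have [g gB gS] := avoiding_selection S B0.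
pose h U := if U == [set: 'I_n.+1]%SET then i else g U.
have hB : selection h B by move=> U UB; rewrite /h; case: eqP => [->|_]; rewrite ?inE // gB.
have /sub /(nesto_facetE _ _ B0) [_] : nesto_facet B S (select_point B h).
  apply/(nesto_facetE _ _ B0); split; first exact: select_point_in.
  rewrite mass_select_point; apply: eq_bigr => U UB; rewrite /h; case: eqP => [->|_].
    rewrite (negbTE iS) finset.subTset; case: eqP => // ST.
    by rewrite ST inE in iS.
  by rewrite gS.
rewrite mass_select_point /min_mass (bigD1 _ BT) [in RHS](bigD1 _ BT) /=.
rewrite /h eqxx iT finset.subTset (negbTE TnT) => massE.
have : \sum_(U in B | U != [set: 'I_n.+1]%SET) (U \subset T)%:R <=
       \sum_(U in B | U != [set: 'I_n.+1]%SET) (h U \in T)%:R :> R.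
  apply: ler_sum => U /andP[UB _]; rewrite ler_nat.
  by have [/fintype.subsetP UT|//] := boolP (U \subset T); rewrite UT ?hB.
by move: massE; rewrite /h /=; lra.
Qed.

Lemma nesto_facet_inj B S T : finset.set0 \notin B -> [set: 'I_n.+1]%SET \in B ->
  S != [set: 'I_n.+1]%SET -> T != [set: 'I_n.+1]%SET ->
  @nesto_facet R n B S = nesto_facet B T -> S = T.
Proof.
move=> B0 BT SnT TnT eqF; apply/eqP; rewrite finset.eqEsubset; apply/andP; split; apply: contraT.
  by move/(nesto_facet_not_sub B0 BT SnT); case; rewrite eqF.
by move/(nesto_facet_not_sub B0 BT TnT); case; rewrite eqF.
Qed.

Lemma mass_setT B x : nestohedron B x -> mass [set: 'I_n.+1]%SET x = #|B|%:R.
Proof.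
move=> [y yP ->]; rewrite mass_sum -sum1_card natr_sum; apply: eq_bigr => T /yP.
move=> /simplex_coord [_ yT <-]; rewrite /mass [LHS](bigID (mem T)) /=.
rewrite [X in _ + X]big1 ?addr0 => [|i /andP[_ /yT]] //.
by apply: eq_bigl => i; rewrite inE.
Qed.

(** A point maximizing u over the Minkowski sum maximizes u in each summand,
    so in the simplex of T only maximizers of u over T carry mass. *)
Lemma face_simplex_support B u T (y : {set 'I_n.+1} -> 'rV[R]_n.+1) i k :
  (forall U, U \in B -> conv_family U (@basis_vec R n.+1) (y U)) ->
  max_face (nestohedron B) u (\sum_(U in B) y U) ->
  T \in B -> k \in T -> i \in T -> u 0 i < u 0 k -> y T 0 i = 0.
Proof.
move=> yP [_ ymax] TB; move: k => k0 k0T iT uik0.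
case: (@arg_maxP _ _ _ k0 (mem T) (fun k => u 0 k) k0T) => k kT kmax.
have uik : u 0 i < u 0 k by apply: lt_le_trans uik0 (kmax _ k0T).
pose y' U := if U == T then basis_vec R k else y U.
have Py' : nestohedron B (\sum_(U in B) y' U).
  exists y' => // U UB; rewrite /y'; case: eqP => [->|_]; last exact: yP.
  exact: basis_vec_simplex.
have := ymax _ Py'; rewrite !dot_sumr (bigD1 _ TB) [X in _ <= X](bigD1 _ TB) /=.
rewrite (eq_bigr (fun U => dot u (y U))) => [|U /andP[_ /negbTE UT]]; last by rewrite /y' UT.
rewrite lerD2r /y' eqxx dotC dot_basis_vec => uk_le.
have [y0 yT y1] := simplex_coord (yP T TB).
have term_ge0 j : j \in T -> 0 <= (u 0 k - u 0 j) * y T 0 j.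
  by move=> jT; rewrite mulr_ge0 // subr_ge0; apply: kmax.
have dotE : dot u (y T) = \sum_(j in T) u 0 j * y T 0 j.
  rewrite /dot (bigID (mem T)) /= [X in _ + X]big1 ?addr0 // => j /yT ->.
  by rewrite mulr0.
have /eqP : \sum_(j in T) (u 0 k - u 0 j) * y T 0 j = 0.
  apply/eqP; rewrite eq_le sumr_ge0 // andbT.
  under eq_bigr do rewrite mulrBl.
  by rewrite sumrB -dotE -mulr_sumr -/(mass T (y T)) y1 mulr1 subr_le0.
rewrite psumr_eq0 // => /allP /(_ i); rewrite mem_index_enum iT => /(_ isT).
by rewrite mulf_eq0 subr_eq0 gt_eqF // => /eqP.
Qed.

(** If u is the functional of the face, take for S a maximal element of the
    building set inside the set of minimizers of u.  A set of the building set
    that meets S but is not inside it contains a non-minimizer, as otherwise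
    its union with S would contradict maximality; so its simplex puts no mass
    on S. *)
Lemma proper_face_in_nesto_facet B F : connected_building_set B ->
  faces (@nestohedron R n B) F -> ~ (nestohedron B `<=` F) ->
  exists2 S, S \in B :\ [set: 'I_n.+1]%SET & F `<=` nesto_facet B S.
Proof.
move=> /andP[/and3P[B0 /forallP B1 BU] BT] [_ [u Fu]] properF.
pose i0 : 'I_n.+1 := [arg min_(i < ord0) u 0 i]%O; pose umin := u 0 i0.
have uminP i : umin <= u 0 i by rewrite /umin /i0; case: arg_minP => // j _; apply.
pose M : {set 'I_n.+1} := [set i | u 0 i == umin]%SET.
have P0 : ([set i0]%SET \in B) && ([set i0]%SET \subset M) by rewrite B1 finset.sub1set inE eqxx.
case: (@arg_maxnP _ [set i0]%SET (fun S => (S \in B) && (S \subset M)) (fun S => #|S|) P0).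
move=> S /andP[SB SM] Smax.
exists S.
  (* otherwise u is constant, and so is its value on the nestohedron *)
  rewrite !inE SB andbT; apply: contra_notN properF => /eqP ST x Px.
  rewrite Fu; split=> // z Pz.
  have uc i : u 0 i = umin.
    by apply/eqP; have /fintype.subsetP /(_ i) := SM; rewrite ST !inE; apply.
  suff du t : nestohedron B t -> dot u t = umin * #|B|%:R by rewrite !du.
  move=> Pt; rewrite -(mass_setT Pt) mulr_sumr /dot.
  by apply: eq_big => [i|i _]; rewrite ?inE // uc.
move=> x; rewrite Fu => xF; have [[y yP xE] _] := xF; rewrite xE in xF *.
apply/(nesto_facetE _ _ B0); split; first by exists y.
rewrite mass_sum; apply: eq_bigr => T TB.
have [y0 yT y1] := simplex_coord (yP T TB).
have [TS|nTS] := boolP (T \subset S).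
  apply/eqP; rewrite eq_le; apply/andP; split; last first.
    by have := mass_simplex_lb S (yP T TB); rewrite TS.
  rewrite -y1 /mass (bigID (mem T)) /= [X in _ + X]big1 ?addr0 => [|i /andP[_ /yT]] //.
  rewrite le_eqVlt; apply/orP; left; apply/eqP/eq_bigl => i.
  by case: (boolP (i \in T)) => [/(fintype.subsetP TS) ->|_]; rewrite ?andbF.
apply: big1 => i iS; have [iT|/yT //] := boolP (i \in T).
have SUT : S :|: T \in B.
  have /forallP /(_ S) := BU; rewrite SB /= => /forallP /(_ T); rewrite TB /=.
  by move=> /implyP; apply; apply/finset.set0Pn; exists i; rewrite inE iS.
have [k kT kM] : exists2 k, k \in T & k \notin M.
  apply/fintype.subsetPn; apply: contra nTS => TM.
  have := Smax (S :|: T)%SET; rewrite SUT finset.subUset SM TM => /(_ isT) leS.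
  have /eqP -> : S == (S :|: T)%SET by rewrite eqEcard finset.subsetUl.
  exact: finset.subsetUr.
apply: (face_simplex_support yP xF TB kT iT).
have /fintype.subsetP /(_ i iS) := SM; rewrite inE => /eqP ->.
by rewrite lt_neqAle uminP andbT eq_sym; rewrite inE in kM.
Qed.

End NestohedronFaces.

(** * The cubical start *)

Lemma set0_notin_building n (B : {set {set 'I_n.+1}}) :
  building_set B -> finset.set0 \notin B.
Proof. by case/and3P. Qed.

Section CubicalStart.
Variables (R : realType) (n : nat) (B0 : {set {set 'I_n.+1}}).
Variables (phi : set 'rV[R]_n.+1 -> set 'rV[R]_n).
Variables (l : {set 'I_n.+1} -> 'rV[R]_n) (b : {set 'I_n.+1} -> R).
Hypothesis B0_connected : connected_building_set B0.
Hypothesis start : cubical_start B0 phi l b.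

Let A0 := (B0 :\ [set: 'I_n.+1])%SET.

Lemma dot_signed_basis (s : bool) (i : 'I_n) (x : 'rV[R]_n) :
  dot ((-1) ^+ s *: basis_vec R i) x = (-1) ^+ s * x 0 i.
Proof. by rewrite dotZl dot_basis_vec. Qed.

Lemma cubical_normal S : S \in A0 -> exists (s : bool) i, l S = (-1) ^+ s *: basis_vec R i.
Proof.
move=> /(proj2 start) [[i [->|->]] _ _].
  by exists false, i; rewrite expr0 scale1r.
by exists true, i; rewrite expr1 scaleN1r.
Qed.

Lemma cubical_normal_inj S T : S \in A0 -> T \in A0 -> l S = l T -> S = T.
Proof.
move=> SA TA lST; have /andP[Bb BT] := B0_connected; have B00 := set0_notin_building Bb.
have [[[_ phi_inj _] _] normal] := start.
have [_ [_ phiS] _] := normal S SA; have [_ [_ phiT] _] := normal T TA.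
move: (SA) (TA); rewrite !inE => /andP[SnT _] /andP[TnT _].
apply: (@nesto_facet_inj R n B0) => //; apply: phi_inj; rewrite ?inE.
- exact: nesto_facet_face.
- exact: nesto_facet_face.
- by rewrite phiS phiT lST.
Qed.

(** The facet of the cube with normal plus or minus e_i comes from a proper
    face of the nestohedron, which lies in some F_S; hence that facet lies in
    the one with normal l S, and its centre shows that the normals agree. *)
Lemma cubical_normal_surj (s : bool) (i : 'I_n) :
  exists2 S, S \in A0 & l S = (-1) ^+ s *: basis_vec R i.
Proof.
have /andP[Bb BT] := B0_connected; have B00 := set0_notin_building Bb.
have [[[phi_faces _ phi_surj] phi_le] normal] := start.
pose e : 'rV[R]_n := (-1) ^+ s *: basis_vec R i.
have sgn2 (t : bool) : (-1) ^+ t * (-1) ^+ t = 1 :> R by rewrite -expr2 sqrr_sign.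
have le1 (t : bool) (x : R) : -1 <= x <= 1 -> (-1) ^+ t * x <= 1.
  by case: t => /andP[? ?]; rewrite ?expr1 ?expr0; lra.
have sgn_le1 (t c : bool) : -1 <= ((-1) ^+ t * c%:R : R) <= 1.
  by case: t; case: c; rewrite /= ?expr0 ?expr1; lra.
have ce : cube e.
  by move=> j; rewrite !mxE eqxx sgn_le1.
have ee : dot e e = 1 by rewrite dot_signed_basis !mxE !eqxx mulr1 sgn2.
have Ge : max_face (@cube R n) e e.
  by split=> // y cy; rewrite ee dot_signed_basis le1.
have fG : faces (@cube R n) (max_face (@cube R n) e) by split; [exists e | exists e].
have c0 : cube (0 : 'rV[R]_n) by move=> j; rewrite mxE; lra.
have fC : faces (@cube R n) (@cube R n).
  split; first by exists 0.
  by exists 0; apply/seteqP; split=> [x Px|x []] //; split=> // y _; rewrite !dot0l.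
have [F fF FG] := phi_surj _ fG; have [F' fF' F'C] := phi_surj _ fC.
have fP := nestohedron_face R B00.
have F'P : F' `<=` nestohedron B0 by case: fF' => _ [u ->] x [].
have properF : ~ (nestohedron B0 `<=` F).
  move=> PF; have /(phi_le _ _ fF' fF) : F' `<=` F by apply: subset_trans PF.
  rewrite F'C FG => /(_ 0 c0) [_ /(_ e ce)].
  by rewrite dot0r ee ler10.
have [S SA FS] := proper_face_in_nesto_facet B0_connected fF properF.
exists S => //; have [_ [_ phiS] _] := normal S SA.
have /(phi_le _ _ fF (nesto_facet_face R S B00)) := FS.
have [t [j lS]] := cubical_normal SA.
rewrite FG phiS lS => /(_ e Ge) [_ /(_ ((-1) ^+ t *: basis_vec R j))].
rewrite !dot_signed_basis !mxE !eqxx mulr1 sgn2 => H.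
have {}H : 1 <= (-1) ^+ t * ((-1) ^+ s * (j == i)%:R) :> R.
  by apply: H => k; rewrite !mxE eqxx sgn_le1.
case: eqVneq H => [->|_]; last by rewrite !mulr0 ler10.
by case: (s); case: (t) => //; rewrite /= ?expr0 ?expr1 => H; exfalso; move: H; lra.
Qed.

Lemma cubical_smooth : smooth l b A0.
Proof.
have b1 S : S \in A0 -> b S = 1 by move=> /(proj2 start) [].
split.
- exists 1 => x Px i.
  have le1 (s : bool) : (-1) ^+ s * x 0 i <= 1.
    have [S SA lS] := cubical_normal_surj s i.
    by have := Px S SA; rewrite lS b1 // dot_signed_basis.
  have := le1 true; have := le1 false; rewrite expr0 expr1 ler_norml; lra.
- by exists 0 => S SA; rewrite dot0r b1.
move=> v [Pv nondeg].
have wallP i : exists p : {set 'I_n.+1} * bool,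
    [/\ p.1 \in A0, tight l b p.1 v & l p.1 = (-1) ^+ p.2 *: basis_vec R i].
  apply: contrapT => noS.
  have /eqP : basis_vec R i = 0.
    apply: nondeg => S SA tS; have [s [j lS]] := cubical_normal SA.
    rewrite lS dot_signed_basis mxE eqxx /=.
    case: eqVneq => [ji|_]; last by rewrite mulr0.
    by case: noS; exists (S, s); rewrite -ji.
  by move=> /eqP /rowP /(_ i) /eqP; rewrite !mxE !eqxx oner_eq0.
have [p pP] := choice wallP.
pose f i := (p i).1; pose s i := (p i).2.
have sgnD (i j : 'I_n) (t r : bool) :
    (-1) ^+ t *: basis_vec R i = (-1) ^+ r *: basis_vec R j -> i = j.
  move=> /rowP /(_ i); rewrite !mxE !eqxx mulr1.
  by case: eqVneq => // _ /eqP; rewrite mulr0 signr_eq0.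
exists f, (diag_mx (\row_i (-1) ^+ (s i))); split.
- move=> i j fij; have [_ _ li] := pP i; have [_ _ lj] := pP j.
  by move: li; rewrite -/(f i) fij lj => /sgnD.
- move=> S; split=> [[SA tS]|[i ->]]; last by have [] := pP i.
  have [t [j lS]] := cubical_normal SA; exists j.
  have [fA ft lf] := pP j; apply: cubical_normal_inj => //; rewrite lS lf.
  move: tS ft; rewrite /tight lS lf !dot_signed_basis !b1 // => tS ft.
  congr (_ *: _); have vj : v 0 j != 0.
    by apply/eqP => v0; move: tS; rewrite v0 mulr0 => /eqP; rewrite eq_sym oner_eq0.
  by apply: (mulIf vj); rewrite tS ft.
- move=> i; have [_ _ ->] := pP i; apply/rowP => j; rewrite !mxE eqxx /=.
  rewrite [j == i]eq_sym; case: (i == j); last by rewrite mulr0.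
  by rewrite mulr1 mulr1n rmorphXn rmorphN1.
- have : diag_mx (\row_i (-1) ^+ s i) *m diag_mx (\row_i (-1) ^+ s i) = 1%:M :> 'M[int]_n.
    rewrite mulmx_diag -diag_const_mx; congr diag_mx.
    by apply/rowP => i; rewrite !mxE -expr2 sqrr_sign.
  by case/mulmx1_unit.
Qed.

End CubicalStart.

(** * The shaving construction *)

Theorem proposition11 (R : realType) (n : nat) (B : {set {set 'I_n.+1}})
    (B_connected : connected_building_set B)
    (B_flag : flag (@nestohedron R n B))
    (B0 : {set {set 'I_n.+1}}) (phi : set 'rV[R]_n.+1 -> set 'rV[R]_n)
    (N : nat) (Bs : nat -> {set {set 'I_n.+1}}) (s : seq {set 'I_n.+1})
    (l : {set 'I_n.+1} -> 'rV[R]_n) (b : {set 'I_n.+1} -> R)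
    (construction : shaving_construction B B0 phi N Bs s l b) :
  delzant [set x : 'rV[R]_n |
             forall S, S \in (B :\ [set: 'I_n.+1])%SET -> dot (l S) x <= b S].
Proof.
have [[B0_connected B0B] start [Bs0 BsN chain] [uniq_s sE order_s _] steps] := construction.
have /andP[B0_building B0T] := B0_connected.
have Bs_building i : (i <= N)%N -> building_set (Bs i).
  case: i => [|i] iN; first by rewrite Bs0.
  by have [S _ /minsetP [/andP[]]] := chain i iN.
(* the inequalities present after k shavings *)
pose A k := ((B0 :\ [set: 'I_n.+1]) :|: [set T in take k s])%SET.
have smooth_A k : (k <= size s)%N -> smooth l b (A k).
  elim: k => [_|k IH ks].
    have -> : A 0%N = (B0 :\ [set: 'I_n.+1])%SET.
      by apply/setP => T; rewrite !inE take0 in_nil orbF.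
    exact: cubical_smooth B0_connected start.
  have {}IH := IH (ltnW ks); pose S := nth finset.set0 s k.
  have kS : index S s = k by rewrite index_uniq.
  have Ss : S \in s by apply: mem_nth.
  have AS : A k.+1 = S |: A k.
    apply/setP => T; rewrite !inE (take_nth finset.set0) // mem_rcons inE -/S.
    by case: (T == S); rewrite ?orbT.
  have [SB0 SB] : S \notin B0 /\ S \in B by move: Ss; rewrite sE inE => /andP[].
  have [i iN SBs] : exists2 i, (i < N)%N & S \in Bs i.+1 :\: Bs i.
    have exN : exists i, S \in Bs i by exists N; rewrite BsN.
    have [[|i] Si Smin] := ex_minnP exN; first by rewrite Bs0 (negbTE SB0) in Si.
    exists i; first by apply: Smin; rewrite BsN.
    by rewrite inE Si andbT; apply/negP => /Smin; rewrite ltnn.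
  have [S1 [S2 [[S1B S2B S12 SU] [lS [eps eps0 bS] cut]]]] := steps i S iN SBs.
  have Bi_building := Bs_building i (ltnW iN).
  have nonempty T : T \in Bs i -> T != finset.set0.
    by apply: contraTneq => ->; apply: set0_notin_building.
  have notT T U : U \in Bs i -> T :&: U = finset.set0 -> T != [set: 'I_n.+1]%SET.
    by move=> /nonempty U0 TU; apply: contraNneq U0 => TT; rewrite -TU TT finset.setTI.
  (* elements of an earlier layer precede S in the enumeration *)
  have inA T : T \in Bs i -> T != [set: 'I_n.+1]%SET -> T \in A k.
    move=> TB TnT; rewrite /A !inE TnT /=; have [//|TB0] := boolP (T \in B0).
    have := order_s i T S iN; rewrite !inE TB0 TB => /(_ isT).
    move: SBs; rewrite inE => -> /(_ isT); rewrite kS => ltk.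
    by rewrite in_take // -index_mem (ltn_trans ltk).
  rewrite AS; apply: (smooth_shave (S1 := S1) (S2 := S2) IH _ _ _ _ lS eps0 bS).
  - by apply: inA => //; apply: (notT _ S2).
  - by apply: inA => //; apply: (notT _ S1); rewrite // finset.setIC.
  - by apply: contraTneq (nonempty _ S1B) => e12; rewrite -S12 -e12 finset.setIid eqxx.
  - rewrite /A !inE (negbTE SB0) andbF /=.
    by rewrite in_take // kS ltnn.
  - by move=> v; have := cut v; rewrite kS.
have <- : A (size s) = (B :\ [set: 'I_n.+1])%SET.
  apply/setP => T; rewrite !inE take_size sE inE.
  have [TB0|TB0] := boolP (T \in B0).
    by rewrite /= orbF ((fintype.subsetP B0B) _ TB0).
  by rewrite andbF /=; case: eqVneq TB0 => [->|//]; rewrite B0T.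
by apply: smooth_delzant; apply: smooth_A.
Qed.
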